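(* Let $\omega, C_1, C_2$ be real constants, and let $\alpha_2$ be a strictly positive (three times differentiable) real function of $t$ on an interval satisfying $$\alpha_2'''(t)+4\omega^2\alpha_2'(t)-\big[C_1\cos(\omega t)+C_2\sin(\omega t)\big]\alpha_2(t)^{-5/2}=0 .$$ Put $g(t)=\alpha_2(t)^{-5/2}$ and $\alpha_1(t)=\tfrac12 C_1\cos(\omega t)+\tfrac12 C_2\sin(\omega t)$. Then the function $$I(z,p,t)=\alpha_2(t)p^2-\alpha_2'(t)zp+\alpha_1(t)p+\Big(\omega^2\alpha_2(t)+\tfrac12\alpha_2''(t)\Big)z^2-\alpha_1'(t)z+\tfrac23\alpha_2(t)g(t)z^3$$ is an exact invariant of the nonlinear oscillator $$z''+\omega^2 z+g(t)z^2=0,$$ that is, for every solution $z(t)$ of this equation, with $p(t)=z'(t)$, one has $\frac{d}{dt}I(z(t),p(t),t)=0$ for all $t$ at which the solution is defined.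
   Context: All quantities are real and primes denote derivatives with respect to $t$. The function $\alpha_2$ is taken strictly positive so that the power $\alpha_2^{-5/2}$ is real. *)

(* Defs.v *)
From Stdlib Require Import Reals.
From Coquelicot Require Import Coquelicot.
Open Scope R_scope.

(* Nondegenerate interval of any kind (open, closed, half-open, bounded or
   not).  Nondegeneracy makes the derivatives below unique. *)
Definition is_interval (J : R -> Prop) : Prop :=
  (forall x y t, J x -> J y -> x <= t <= y -> J t) /\
  (exists x y, J x /\ J y /\ x < y).

(* [D_in f f' J t] takes the limit of the difference quotients within [J]: it
   is the ordinary derivative at interior points of [J], and the one-sided one
   at an endpoint belonging to [J]. *)
Definition derivative_on (J : R -> Prop) (f f' : R -> R) : Prop :=
  forall t, J t -> D_in f f' J t.

(* [Rpower x y] is [exp (y * ln x)], the real power only for [0 < x]. *)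
Definition g (alpha2 : R -> R) (t : R) : R := Rpower (alpha2 t) (- (5 / 2)).

Definition alpha1 (omega C1 C2 t : R) : R :=
  1 / 2 * C1 * cos (omega * t) + 1 / 2 * C2 * sin (omega * t).

(* [alpha2'] and [alpha2''] are meant to be the derivatives of [alpha2]. *)
Definition oscillator_I (omega C1 C2 : R) (alpha2 alpha2' alpha2'' : R -> R)
    (z p t : R) : R :=
  alpha2 t * p ^ 2 - alpha2' t * z * p + alpha1 omega C1 C2 t * p
  + (omega ^ 2 * alpha2 t + 1 / 2 * alpha2'' t) * z ^ 2
  - Derive (alpha1 omega C1 C2) t * z
  + 2 / 3 * alpha2 t * g alpha2 t * z ^ 3.

(* [z] solves z'' + omega^2 z + gamma z^2 = 0 on [K], with z' = [p]. *)
Definition oscillator_solution (omega : R) (gamma : R -> R) (K : R -> Prop)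
    (z p : R -> R) : Prop :=
  derivative_on K z p /\
  exists z'' : R -> R, derivative_on K p z'' /\
    forall t, K t -> z'' t + omega ^ 2 * z t + gamma t * z t ^ 2 = 0.

(* [F z p t] is constant in the differential sense along every solution,
   whatever the subinterval [K] of [J] on which the solution is defined. *)
Definition exact_invariant (omega : R) (gamma : R -> R) (J : R -> Prop)
    (F : R -> R -> R -> R) : Prop :=
  forall (K : R -> Prop) (z p : R -> R),
    is_interval K -> (forall t, K t -> J t) ->
    oscillator_solution omega gamma K z p ->
    derivative_on K (fun t => F (z t) (p t) t) (fun _ => 0).

(* Main.v *)
Require Import Defs.
From Stdlib Require Import Reals Lra.
From Coquelicot Require Import Coquelicot.
Open Scope R_scope.

(** Differentiate [I] along a solution and substitute [z'' = - omega^2 z - g z^2].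
    All terms containing [p] cancel; the coefficient of [z] vanishes since
    [alpha1'' = - omega^2 alpha1], that of [z^2] is half the equation satisfied
    by [alpha2], and that of [z^3] vanishes since
    [alpha2 g' = - (5/2) g alpha2']. *)

(** Chain rule with an unrestricted outer function: [Dcomp] yields the domain [Dgf D no_cond f],
    whose condition on [f s] is trivial, so it contains [D]. *)
Lemma D_in_comp_derivable (D : R -> Prop) (f f' phi : R -> R) (l t : R) :
  D_in f f' D t -> derivable_pt_lim phi (f t) l ->
  D_in (fun s => phi (f s)) (fun s => f' s * l) D t.
Proof.
  intros Hf Hphi.
  apply (D_in_imp _ _ (Dgf D no_cond f)).
  - intros s Hs; split; [exact Hs | exact I].
  - refine (Dcomp D no_cond f' (fun _ => l) f phi t Hf _).
    now apply derivable_pt_lim_D_in.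
Qed.

Lemma D_in_pow (D : R -> Prop) (n : nat) (f f' : R -> R) (t : R) :
  D_in f f' D t ->
  D_in (fun s => f s ^ n) (fun s => f' s * (INR n * f t ^ pred n)) D t.
Proof.
  intros Hf.
  refine (D_in_comp_derivable D f f' (fun x => x ^ n) _ t Hf _).
  apply derivable_pt_lim_pow.
Qed.

Lemma D_in_of_derivable (D : R -> Prop) (f : R -> R) (l t : R) :
  derivable_pt_lim f t l -> D_in f (fun _ => l) D t.
Proof.
  intros Hf.
  apply (D_in_imp _ _ no_cond); [intros s _; exact I |].
  now apply derivable_pt_lim_D_in.
Qed.

Lemma is_derive_alpha1 (omega C1 C2 t : R) :
  is_derive (alpha1 omega C1 C2) t
    (omega * (1 / 2 * C2 * cos (omega * t) - 1 / 2 * C1 * sin (omega * t))).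
Proof. unfold alpha1; auto_derive; [exact I | ring]. Qed.

Lemma is_derive_Derive_alpha1 (omega C1 C2 t : R) :
  is_derive (Derive (alpha1 omega C1 C2)) t (- omega ^ 2 * alpha1 omega C1 C2 t).
Proof.
  apply (is_derive_ext (fun s =>
    omega * (1 / 2 * C2 * cos (omega * s) - 1 / 2 * C1 * sin (omega * s)))).
  - intros s; symmetry; apply is_derive_unique, is_derive_alpha1.
  - unfold alpha1; auto_derive; [exact I | ring].
Qed.

(** Writing the power [-7/2] as [g a t / a t] keeps the derivative rational in [g] and [a], so that
    the final identity is within reach of [field]. *)
Lemma D_in_g (D : R -> Prop) (a a' : R -> R) (t : R) :
  0 < a t -> D_in a a' D t ->
  D_in (g a) (fun s => - (5 / 2) * a' s * (g a t / a t)) D t.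
Proof.
  intros Hpos Ha.
  apply (D_in_ext (fun s => a' s * (- (5 / 2) * Rpower (a t) (- (5 / 2) - 1)))).
  - unfold Rminus, g.
    rewrite Rpower_plus, (Rpower_Ropp _ 1), Rpower_1 by exact Hpos.
    unfold Rdiv; ring.
  - refine (D_in_comp_derivable D a a' (fun x => Rpower x (- (5 / 2))) _ t Ha _).
    now apply derivable_pt_lim_power.
Qed.

Theorem mainTheorem1
  (omega C1 C2 : R) (J : R -> Prop)
  (alpha2 alpha2' alpha2'' alpha2''' : R -> R)
  (HJ : is_interval J)
  (Hpos : forall t, J t -> 0 < alpha2 t)
  (Hd1 : derivative_on J alpha2 alpha2')
  (Hd2 : derivative_on J alpha2' alpha2'')
  (Hd3 : derivative_on J alpha2'' alpha2''')
  (Hode : forall t, J t ->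
     alpha2''' t + 4 * omega ^ 2 * alpha2' t
     - (C1 * cos (omega * t) + C2 * sin (omega * t))
       * Rpower (alpha2 t) (- (5 / 2)) = 0) :
  exact_invariant omega (g alpha2) J
    (oscillator_I omega C1 C2 alpha2 alpha2' alpha2'').
Proof.
  intros K z p HK HKJ [Hz [z'' [Hp Heq]]] t Ht.
  pose proof (HKJ t Ht) as HtJ.
  pose proof (Hpos t HtJ) as Ha.
  pose proof (D_in_imp _ _ _ _ _ HKJ (Hd1 t HtJ)) as D1.
  pose proof (D_in_imp _ _ _ _ _ HKJ (Hd2 t HtJ)) as D2.
  pose proof (D_in_imp _ _ _ _ _ HKJ (Hd3 t HtJ)) as D3.
  pose proof (Hz t Ht) as Dz.
  pose proof (Hp t Ht) as Dp.
  pose proof (D_in_g _ _ _ _ Ha D1) as Dg.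
  pose proof (D_in_of_derivable K _ _ t
    (proj1 (is_derive_Reals _ _ _) (is_derive_alpha1 omega C1 C2 t))) as Dal.
  pose proof (D_in_of_derivable K _ _ t
    (proj1 (is_derive_Reals _ _ _) (is_derive_Derive_alpha1 omega C1 C2 t))) as Dal'.
  pose proof (is_derive_unique _ _ _ (is_derive_alpha1 omega C1 C2 t)) as Eal'.
  unfold oscillator_I.
  (* [D_in] sees only the value of the derivative at [t], so one equation between reals remains; the
     differentiation rules go first, to fill in its unknown side. *)
  eapply D_in_ext; cycle 1.
  - repeat first
      [ eassumption
      | apply Dconst
      | eapply D_in_pow
      | eapply Dminus
      | eapply Dadd
      | eapply Dmult ].
  (* [Derive alpha1] from the term [- alpha1' * p] must meet the explicit formula that [Dal]
     produces for the same derivative. *)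
  - cbv beta; cbn [INR pred]; rewrite Eal'.
    pose proof (Heq t Ht) as E1.
    pose proof (Hode t HtJ) as E2; change (Rpower _ _) with (g alpha2 t) in E2.
    replace (z'' t) with (- omega ^ 2 * z t - g alpha2 t * z t ^ 2) by lra.
    (* The bracket in the equation for [alpha2] is [2 * alpha1]; left folded, [alpha1] is an atom
       shared with the other terms. *)
    replace (alpha2''' t) with
      (2 * alpha1 omega C1 C2 t * g alpha2 t - 4 * omega ^ 2 * alpha2' t)
      by (unfold alpha1; lra).
    (* The only denominator is [alpha2 t], brought in by [D_in_g]. *)
    field; lra.
Qed.
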